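(* For each $n$, let $p=p_n$ and let $\mathbf X_1,\ldots,\mathbf X_n$ be i.i.d. random vectors in $\mathbb R^p$ whose coordinates have continuous marginal distribution functions $F_1,\ldots,F_p$. Assume $p/n\to y\in(0,\infty)$. Then $$L\big(F^{\boldsymbol\rho_n},F^{\mathbf W_n}\big)\to 0\quad\text{almost surely}.$$
   Context: $\mathbf X_i=(x_{i1},\ldots,x_{ip})^\top$. Ranks $r_{ij}=1+\sum_{k\ne i}I(x_{kj}\le x_{ij})$; standardized ranking matrix $\mathbf R=\big(\sqrt{12/(n^2-1)}\,(r_{ij}-\tfrac{n+1}{2})\big)_{n\times p}$; Spearman's rank correlation matrix $\boldsymbol\rho_n=\frac1n\mathbf R^\top\mathbf R$. $\mathbf A_i=\mathbb E\{\mathrm{sign}(\mathbf X_i-\mathbf X_k)\mid\mathbf X_i\}=(2F_1(x_{i1})-1,\ldots,2F_p(x_{ip})-1)^\top$ ($k\ne i$), and $\mathbf W_n=\frac3n\sum_{i=1}^n\mathbf A_i\mathbf A_i^\top$. $F^{\mathbf H}(x)=\frac1p\sum_i I(\lambda_i(\mathbf H)\le x)$ is the empirical spectral distribution and $L$ the Lévy distance. *)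

(* Defs.v *)
From HB Require Import structures.
From mathcomp Require Import all_boot all_order all_algebra.
From mathcomp Require Import all_classical all_reals all_analysis.
Set Implicit Arguments. Unset Strict Implicit. Unset Printing Implicit Defensive.
Import Order.TTheory GRing.Theory Num.Theory numFieldNormedType.Exports.
Local Open Scope classical_set_scope.
Local Open Scope ring_scope.

Section Defs.
Variable R : realType.

(* A spectrum (eigenvalues with algebraic multiplicity) of a square matrix
   whose characteristic polynomial splits over R (always the case for the real
   symmetric matrices rho_n and W_n considered here); [::] otherwise.  Any two
   such sequences are permutations of each other, so the ESD below is
   independent of the choice. *)
Definition is_spectrum (p : nat) (H : 'M[R]_p) (s : seq R) : Prop :=
  char_poly H = \prod_(r <- s) ('X - r%:P).

Definition spectrum (p : nat) (H : 'M[R]_p) : seq R :=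
  match pselect (exists s, is_spectrum H s) with
  | left e => projT1 (cid e)
  | right _ => [::]
  end.

Definition esd (p : nat) (H : 'M[R]_p) (x : R) : R :=
  (count (fun l => l <= x) (spectrum H))%:R / p%:R.

Definition levy (F G : R -> R) : R :=
  inf [set e : R | 0 < e /\
        forall x, F (x - e) - e <= G x /\ G x <= F (x + e) + e].

Definition rank_of (n p : nat) (x : 'I_n -> 'I_p -> R) (i : 'I_n) (j : 'I_p) : nat :=
  1 + #|[set k : 'I_n | (k != i) && (x k j <= x i j)]|.

Definition std_rank_mx (n p : nat) (x : 'I_n -> 'I_p -> R) : 'M[R]_(n, p) :=
  \matrix_(i < n, j < p)
    (Num.sqrt (12 / (n%:R ^+ 2 - 1)) *
       ((rank_of x i j)%:R - (n%:R + 1) / 2)).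

Definition spearman (n p : nat) (x : 'I_n -> 'I_p -> R) : 'M[R]_p :=
  n%:R^-1 *: ((std_rank_mx x)^T *m std_rank_mx x).

(* W_n = (3/n) sum_i A_i A_i^T with A_i = (2 F_j(x_ij) - 1)_j ; F i j is the
   distribution function of the j-th coordinate of the i-th vector (for i.i.d.
   vectors it does not depend on i, so F i j = F_j). *)
Definition Wmat (n p : nat) (F : 'I_n -> 'I_p -> R -> R) (x : 'I_n -> 'I_p -> R) : 'M[R]_p :=
  (3 / n%:R) *: \sum_(i < n)
     (let A : 'cV[R]_p := \col_(j < p) (2 * F i j (x i j) - 1) in A *m A^T).

End Defs.

Section Prob.
Variables (d : measure_display) (T : measurableType d) (R : realType).
Variable P : probability T R.

Definition borel_vec (p : nat) : set (set ('I_p -> R)) :=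
  <<s [set [set v : 'I_p -> R | forall j, B j (v j)] |
        B in [set B : 'I_p -> set R | forall j, measurable (B j)]] >>.

Definition random_vector (p : nat) (Y : T -> ('I_p -> R)) : Prop :=
  forall j, measurable_fun setT (fun w => Y w j).

Definition mutually_independent (n p : nat) (Y : 'I_n -> T -> ('I_p -> R)) : Prop :=
  forall A : 'I_n -> set ('I_p -> R), (forall i, borel_vec (A i)) ->
    P (\bigcap_(i in [set: 'I_n]) (Y i @^-1` A i)) =
    (\prod_(i < n) P (Y i @^-1` A i))%E.

Definition identically_distributed (n p : nat) (Y : 'I_n -> T -> ('I_p -> R)) : Prop :=
  forall i k (A : set ('I_p -> R)), borel_vec A ->
    P (Y i @^-1` A) = P (Y k @^-1` A).

Definition dist_fun (Z : T -> R) (x : R) : R := fine (P [set w | Z w <= x]).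

End Prob.

(* Main.v *)
Require Import Defs.
From HB Require Import structures.
From mathcomp Require Import all_boot all_order all_algebra.
From mathcomp Require Import complex.
From mathcomp Require Import all_classical all_reals all_analysis.
From mathcomp Require Import measurable_realfun ring lra.
Import Order.TTheory GRing.Theory Num.Theory numFieldNormedType.Exports.
Set Implicit Arguments. Unset Strict Implicit. Unset Printing Implicit Defensive.
Local Open Scope classical_set_scope.
Local Open Scope ring_scope.

(* The spectral half is deterministic.  Write the two matrices as Gram matrices
   a S^T S and a T^T T.  On the intersection of the span of the eigenvectors of
   the first with eigenvalue <= x and the span of those of the second with
   eigenvalue > x + e, the form of a (T^T T - S^T S) exceeds e; its trace there is
   bounded, by Bessel and AM-GM, through the Frobenius norms of T - S and T + S.
   Counting dimensions, the Levy distance is at most e as soon as the mean squared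
   entry of T - S is O(e^4), those of S and T being bounded.
   The probabilistic half is that ranks are n times empirical distribution
   functions, so T - S is uniformly small once the empirical distribution
   functions of all p coordinates are uniformly close to the true ones.  This
   follows from Chernoff's bound at the points of a quantile grid, a union bound
   over the O(n) coordinates, and Borel-Cantelli. *)

(** * Eigenvalue counting for Gram matrices *)

Section Hermitian.
Local Open Scope sesquilinear_scope.
Variable C : numClosedFieldType.

Lemma mxtrace_mul_conj_ge0 m n (N : 'M[C]_(m, n)) : 0 <= \tr (N *m N^t*).
Proof.
rewrite /mxtrace; apply: sumr_ge0 => i _; rewrite mxE; apply: sumr_ge0 => j _.
by rewrite !mxE mul_conjC_ge0.
Qed.

(** Bessel's inequality in trace form. The rows of [Q] are orthonormal, so [Q^t* *m Q] is an
    orthogonal projection; what it removes from [M] is [N], and the trace of [N *m N^t*] is the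
    difference of the two sides. *)
Lemma mxtrace_unitary_compression_le d m n (Q : 'M[C]_(d, n)) (M : 'M[C]_(m, n)) :
  Q \is unitarymx -> \tr (Q *m (M^t* *m M) *m Q^t*) <= \tr (M^t* *m M).
Proof.
move=> /unitarymxP QQ.
pose N := M - M *m (Q^t* *m Q).
have := mxtrace_mul_conj_ge0 N.
have NE : N *m N^t* = M *m M^t* - M *m (Q^t* *m Q) *m M^t*.
  have EN : N^t* = M^t* - (Q^t* *m Q) *m M^t*.
    rewrite /N linearB /= map_mxB trmx_mul map_mxM trmx_mul map_mxM.
    by rewrite trmxCK.
  rewrite EN /N mulmxBl !mulmxBr opprB !mulmxA -[M *m Q^t* *m Q *m Q^t*]mulmxA.
  by rewrite QQ mulmx1 subrr addr0.
rewrite NE raddfB /= subr_ge0 => h.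
rewrite mxtrace_mulC [leRHS]mxtrace_mulC; apply: le_trans h.
by rewrite [leRHS](_ : _ = \tr (Q^t* *m (Q *m (M^t* *m M)))) // -mulmxA mxtrace_mulC !mulmxA.
Qed.

(** The row spaces of [V] and [U] meet in dimension at least m1 + m2 - n. Each vector of an
    orthonormal basis of the intersection adds at least y - x to the compressed trace of K - G,
    which is at most [b]. *)
Lemma cap_forms_dim_le m1 m2 n (V : 'M[C]_(m1, n)) (U : 'M[C]_(m2, n))
    (G K : 'M[C]_n) (x y : C) (b : C) :
  V \is unitarymx -> U \is unitarymx -> x < y ->
  (forall u : 'rV_n, (u <= V)%MS -> (u *m G *m u^t*) 0 0 <= x * (u *m u^t*) 0 0) ->
  (forall u : 'rV_n, (u <= U)%MS -> y * (u *m u^t*) 0 0 <= (u *m K *m u^t*) 0 0) ->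
  (forall d (Q : 'M[C]_(d, n)), Q \is unitarymx ->
     \tr (Q *m (K - G) *m Q^t*) <= b) ->
  (y - x) * (m1%:R + m2%:R - n%:R) <= b.
Proof.
move=> uV uU xy GV KU trb.
(* Gram-Schmidt on a free basis keeps the span, so the rows of [Q] form an orthonormal basis of
   [Z]. *)
pose Z := (V :&: U)%MS; pose Q := schmidt (row_base Z).
have uQ : Q \is unitarymx by apply: schmidt_unitarymx; exact: rank_leq_col.
have QZ : (Q <= Z)%MS.
  by rewrite (eqmx_schmidt_free (row_base_free Z)) eq_row_base.
have dimZ : (m1 + m2 <= \rank Z + n)%N.
  have := mxrank_sum_cap V U; rewrite (mxrank_unitary uV) (mxrank_unitary uU) => <-.
  by rewrite addnC leq_add2l rank_leq_col.
apply: le_trans (trb _ _ uQ).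
apply: (@le_trans _ _ ((y - x) * (\rank Z)%:R)).
  rewrite ler_pM2l ?subr_gt0 // lerBlDr -!natrD ler_nat //.
rewrite /mxtrace mulr_natr -[X in _ *+ X]card_ord -sumr_const.
apply: ler_sum => i _.
set q := row i Q.
have qq : (q *m q^t*) 0 0 = 1.
  transitivity ((Q *m Q^t*) i i); last by rewrite (unitarymxP uQ) mxE eqxx.
  by rewrite !mxE; apply: eq_bigr => j _; rewrite !mxE.
have -> : (Q *m (K - G) *m Q^t*) i i = (q *m K *m q^t*) 0 0 - (q *m G *m q^t*) 0 0.
  have h (A : 'M[C]_n) : (Q *m A *m Q^t*) i i = (q *m A *m q^t*) 0 0.
    rewrite !mxE; apply: eq_bigr => j _; rewrite !mxE; congr (_ * _).
    by apply: eq_bigr => k _; rewrite !mxE.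
  by rewrite mulmxBr mulmxBl -!h !mxE.
have qZ : (q <= Z)%MS by rewrite (submx_trans (row_sub _ _)).
have := GV q; have := KU q; rewrite qq !mulr1 => h1 h2.
rewrite lerB //.
  by apply: h1; apply: submx_trans qZ (capmxSr _ _).
by apply: h2; apply: submx_trans qZ (capmxSl _ _).
Qed.

Lemma diag_form n (g : 'I_n -> C) (w : 'rV[C]_n) :
  (w *m diag_mx (\row_i g i) *m w^t*) 0 0 = \sum_i g i * (w 0 i * (w 0 i)^*).
Proof.
rewrite mxE; apply: eq_bigr => i _.
rewrite mul_mx_diag !mxE; ring.
Qed.

Lemma unitary_rowsub m n (P : 'M[C]_n) (f : 'I_m -> 'I_n) :
  injective f -> P \is unitarymx -> rowsub f P \is unitarymx.
Proof.
move=> finj /unitarymxP PP; apply/unitarymxP/matrixP => i j.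
transitivity ((P *m P^t*) (f i) (f j)); last by rewrite PP !mxE (inj_eq finj).
by rewrite !mxE; apply: eq_bigr => k _; rewrite !mxE.
Qed.

(** On the span of the eigenvectors selected by [f], both forms are weighted sums in the same
    coordinates [w]. Bounds on the selected eigenvalues thus become bounds on the form of [G], term
    by term. *)
Lemma rowsub_diag_form m n (P G : 'M[C]_n) (g : 'I_n -> C) (f : 'I_m -> 'I_n)
    (u : 'rV[C]_n) :
  injective f -> P \is unitarymx -> P *m G = diag_mx (\row_i g i) *m P ->
  (u <= rowsub f P)%MS ->
  exists w : 'rV[C]_m,
    (u *m u^t*) 0 0 = \sum_i w 0 i * (w 0 i)^* /\
    (u *m G *m u^t*) 0 0 = \sum_i g (f i) * (w 0 i * (w 0 i)^*).
Proof.
move=> finj uP PG /submxP[w ->]; exists w.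
have VV := unitarymxP (unitary_rowsub finj uP).
have VG : rowsub f P *m G = diag_mx (\row_i g (f i)) *m rowsub f P.
  apply/matrixP => i j; have /matrixP/(_ (f i) j) := PG.
  rewrite !mul_diag_mx !mxE => <-.
  by apply: eq_bigr => k _; rewrite !mxE.
split.
  rewrite trmx_mul map_mxM mulmxA -[w *m _ *m _]mulmxA VV mulmx1.
  by rewrite mxE; apply: eq_bigr => i _; rewrite !mxE.
rewrite -(diag_form (g \o f)) trmx_mul map_mxM mulmxA -(mulmxA w) VG.
by rewrite !mulmxA -[w *m _ *m _ *m _]mulmxA VV mulmx1.
Qed.

End Hermitian.

Lemma similar_char_poly (F : fieldType) n (P G D : 'M[F]_n) :
  P \in unitmx -> P *m G = D *m P -> char_poly G = char_poly D.
Proof.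
move=> Pu PG.
have detP : \det (map_mx polyC P) != 0.
  by rewrite det_map_mx polyC_eq0 -unitfE -unitmxE.
apply: (mulfI detP); rewrite -det_mulmx mulrC -det_mulmx; congr (\det _).
by rewrite /char_poly_mx mulmxBr mulmxBl -!map_mxM PG scalar_mxC.
Qed.

(** * Spectra of real symmetric matrices through complexification *)

Section RealGram.
Local Open Scope sesquilinear_scope.
Variable R : realType.
Local Notation C := (complex R).
Local Notation toC := (real_complex R).

Lemma conj_real_complex (x : R) : (toC x)^* = toC x.
Proof. by apply/CrealP/complex_realP; exists x. Qed.

Lemma diagonalization_of_real_symmetric n (H : 'M[R]_n) : H^T = H ->
  exists (P : 'M[C]_n) (g : 'I_n -> R),
    [/\ P \is unitarymx,
        P *m map_mx toC H = diag_mx (\row_i toC (g i)) *m P &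
        char_poly H = \prod_i ('X - (g i)%:P)].
Proof.
move=> Hsym; set HC := map_mx toC H.
have Hherm : HC \is hermsymmx.
  rewrite qualifE /= expr0 scale1r; apply/eqP/matrixP => i j.
  by rewrite !mxE conj_real_complex -{1}Hsym mxE.
have Dreal := hermitian_spectral_diag_real Hherm.
have uP := spectral_unitarymx HC.
have /orthomx_spectralP HE := hermitian_normalmx Hherm.
set P := spectralmx HC in uP HE.
have Punit := unitarymx_unit uP.
pose g i := complex.Re (spectral_diag HC 0 i).
have gE i : toC (g i) = spectral_diag HC 0 i.
  by apply: RRe_real; apply: (mxOverP Dreal).
have DE : \row_i toC (g i) = spectral_diag HC.
  by apply/matrixP => i j; rewrite mxE gE ord1.
have PH : P *m HC = diag_mx (\row_i toC (g i)) *m P.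
  by rewrite {1}HE DE !mulmxA mulmxV // mul1mx.
exists P, g; split => //.
(* The factorization is checked over the complex numbers, where similarity applies, and descends
   because the embedding of polynomials is injective. *)
apply: (map_poly_inj toC).
rewrite map_char_poly -/HC (similar_char_poly Punit PH) char_poly_trig.
  rewrite rmorph_prod; apply: eq_bigr => i _.
  by rewrite rmorphB /= map_polyX map_polyC /= !mxE eqxx.
exact: is_diag_mx_is_trig (diag_mx_is_diag _).
Qed.

(** Factorization into monic linear factors is unique up to order, so the choice made in [spectrum]
    is harmless. *)
Lemma perm_spectrum n (H : 'M[R]_n) (g : 'I_n -> R) :
  char_poly H = \prod_i ('X - (g i)%:P) ->
  perm_eq (spectrum H) [seq g i | i <- enum 'I_n].
Proof.
move=> HE.
have gE : is_spectrum H [seq g i | i <- enum 'I_n].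
  by rewrite /is_spectrum HE big_map big_enum.
rewrite /spectrum; case: pselect => [e|[]]; last by exists [seq g i | i <- enum 'I_n].
case: (cid e) => s /= sE.
by apply: prod_XsubC_eq; rewrite -sE gE.
Qed.

Lemma count_spectrum n (H : 'M[R]_n) (g : 'I_n -> R) (q : pred R) :
  char_poly H = \prod_i ('X - (g i)%:P) ->
  count q (spectrum H) = #|[pred i | q (g i)]|.
Proof.
move=> /perm_spectrum/permP ->.
by rewrite count_map -size_filter cardE enumT.
Qed.

(** The weight [s] is left free so that a small T - S can later be balanced against a merely bounded
    T + S. *)
Lemma gram_difference_trace_le d m n (S T : 'M[R]_(m, n)) (s : R) (Q : 'M[C]_(d, n)) :
  Q \is unitarymx -> s != 0 ->
  \tr (Q *m map_mx toC (T^T *m T - S^T *m S) *m Q^t*) <=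
  toC (2^-1 * (s ^+ 2 * (\sum_i \sum_j (T i j - S i j) ^+ 2) +
               s ^- 2 * (\sum_i \sum_j (T i j + S i j) ^+ 2))).
Proof.
move=> uQ s0.
have gramE (A : 'M[R]_(m, n)) : map_mx toC (A^T *m A) = (map_mx toC A)^t* *m map_mx toC A.
  rewrite map_mxM; congr (_ *m _); apply/matrixP => i j.
  by rewrite !mxE conj_real_complex.
have trgram (A : 'M[R]_(m, n)) : \tr (A^T *m A) = \sum_i \sum_j (A i j) ^+ 2.
  rewrite mxtrace_mulC /mxtrace; apply: eq_bigr => i _.
  by rewrite mxE; apply: eq_bigr => j _; rewrite mxE expr2.
have Qgram (A : 'M[R]_(m, n)) : 0 <= \tr (Q *m map_mx toC (A^T *m A) *m Q^t*) <=
    toC (\sum_i \sum_j (A i j) ^+ 2).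
  apply/andP; split.
    rewrite gramE; set N := Q *m (map_mx toC A)^t*.
    have -> : Q *m ((map_mx toC A)^t* *m map_mx toC A) *m Q^t* = N *m N^t*.
      by rewrite /N trmx_mul map_mxM trmxCK !mulmxA.
    exact: mxtrace_mul_conj_ge0.
  by rewrite -trgram -trace_map_mx gramE; exact: mxtrace_unitary_compression_le.
(* AM-GM: T^T T - S^T S = (D^T E + E^T D) / 2, and N^T N >= 0. *)
pose D := T - S; pose E := T + S; pose N := s *: D - s^-1 *: E.
have id : T^T *m T - S^T *m S =
    2^-1 *: (s ^+ 2 *: (D^T *m D) + s ^- 2 *: (E^T *m E) - N^T *m N).
  rewrite /N /D /E.
  apply/matrixP => i j; rewrite !mxE -!sumrB.
  rewrite !mulr_sumr -big_split -sumrB mulr_sumr /=; apply: eq_bigr => k _.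
  by rewrite !mxE; field; rewrite s0.
rewrite id.
(* The compressed trace is linear in the matrix: the term in [N] is dropped by its sign, the other
   two are bounded by Frobenius norms. *)
pose f (A : 'M[R]_n) := \tr (Q *m map_mx toC A *m Q^t*).
have fZ a A : f (a *: A) = toC a * f A.
  by rewrite /f map_mxZ -scalemxAr -scalemxAl mxtraceZ.
have fD A B : f (A + B) = f A + f B.
  by rewrite /f map_mxD mulmxDr mulmxDl mxtraceD.
have fB A B : f (A - B) = f A - f B.
  by rewrite -scaleN1r fD fZ rmorphN1 mulN1r.
rewrite -/(f _) fZ fB fD !fZ [leRHS]rmorphM /= ler_wpM2l //.
  by rewrite (_ : 0 = toC 0) // lecR invr_ge0.
have /andP[N0 _] := Qgram N; have /andP[_ hD] := Qgram D; have /andP[_ hE] := Qgram E.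
have toCM (u v : R) : toC (u * v) = toC u * toC v := rmorphM _ _ _.
rewrite rmorphD /= (toCM (s ^+ 2)) (toCM (s ^- 2)) lerBlDr; apply: ler_wpDr; first exact: N0.
have toC_ge0 (x : R) : 0 <= x -> 0 <= toC x by rewrite (_ : 0 = toC 0) // lecR.
apply: lerD; apply: ler_wpM2l; rewrite ?toC_ge0 ?sqr_ge0 ?invr_ge0 ?sqr_ge0 //.
  apply: (le_trans hD); rewrite lecR; apply: ler_sum => i _; apply: ler_sum => j _.
  by rewrite !mxE.
apply: (le_trans hE); rewrite lecR; apply: ler_sum => i _; apply: ler_sum => j _.
by rewrite !mxE.
Qed.

(** Dimension counting for the eigenvectors of [H] with eigenvalue at most x and those of [K] with
    eigenvalue above y. The latter number n minus the count of [K] at y, so the excess dimension is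
    the difference of the two counts. *)
Lemma count_spectrum_gram_le m n (S T : 'M[R]_(m, n)) (a s x y : R) :
  0 <= a -> s != 0 -> x < y ->
  (y - x) * ((count (fun l => l <= x) (spectrum (a *: (S^T *m S))))%:R -
             (count (fun l => l <= y) (spectrum (a *: (T^T *m T))))%:R) <=
  a * (2^-1 * (s ^+ 2 * (\sum_i \sum_j (T i j - S i j) ^+ 2) +
               s ^- 2 * (\sum_i \sum_j (T i j + S i j) ^+ 2))).
Proof.
move=> a0 s0 xy.
set H := a *: (S^T *m S); set K := a *: (T^T *m T).
have symg (A : 'M[R]_(m, n)) : (a *: (A^T *m A))^T = a *: (A^T *m A).
  by rewrite linearZ /= trmx_mul trmxK.
have [P [g [uP PH gE]]] := diagonalization_of_real_symmetric (symg S).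
have [P' [k [uP' PK kE]]] := diagonalization_of_real_symmetric (symg T).
rewrite (count_spectrum _ gE) (count_spectrum _ kE).
set I := [pred i | g i <= x].
pose J := [pred i | ~~ (k i <= y)].
pose J' := [pred i | k i <= y].
have cJ : (#|J'| + #|J| = n)%N by rewrite -[RHS]card_ord -(cardC J').
have inj_ev (A : pred 'I_n) : injective (fun i : 'I_#|A| => enum_val i).
  by move=> i j; apply: enum_val_inj.
have toC_ge0 (z : R) : 0 <= z -> 0 <= toC z by rewrite (_ : 0 = toC 0) // lecR.
have cf := @cap_forms_dim_le C _ _ _ _ _ (map_mx toC H) (map_mx toC K) (toC x) (toC y)
  (toC (a * (2^-1 * (s ^+ 2 * (\sum_i \sum_j (T i j - S i j) ^+ 2) +
               s ^- 2 * (\sum_i \sum_j (T i j + S i j) ^+ 2)))))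
  (unitary_rowsub (inj_ev I) uP) (unitary_rowsub (inj_ev J) uP').
have {cf} : (toC y - toC x) * (#|I|%:R + #|J|%:R - n%:R) <=
   toC (a * (2^-1 * (s ^+ 2 * (\sum_i \sum_j (T i j - S i j) ^+ 2) +
               s ^- 2 * (\sum_i \sum_j (T i j + S i j) ^+ 2)))).
  apply: cf.
  - by rewrite ltcR.
  - move=> u /(rowsub_diag_form (inj_ev I) uP PH)[w [-> ->]].
    rewrite mulr_sumr; apply: ler_sum => i _.
    rewrite ler_wpM2r ?mul_conjC_ge0 // lecR.
    exact: (enum_valP i).
  - move=> u /(rowsub_diag_form (inj_ev J) uP' PK)[w [-> ->]].
    rewrite mulr_sumr; apply: ler_sum => i _.
    rewrite ler_wpM2r ?mul_conjC_ge0 // lecR.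
    by apply/ltW; rewrite ltNge; exact: (enum_valP i).
  - move=> d Q uQ; rewrite -map_mxB -scalerBr map_mxZ -scalemxAr -scalemxAl mxtraceZ.
    by rewrite rmorphM ler_wpM2l ?toC_ge0 //; exact: gram_difference_trace_le.
rewrite -[X in _ * (_ - X%:R)]cJ natrD.
rewrite -rmorphB -!(rmorph_nat toC) -!rmorphD -rmorphB -rmorphM lecR.
congr (_ * _ <= _); ring.
Qed.

End RealGram.

(** * Ranks and the Levy distance *)

Section Levy.
Variable R : realType.

Lemma levy_ge0 (F G : R -> R) : 0 <= levy F G.
Proof.
rewrite /levy; set A := [set _ | _].
(* The infimum of the empty set is 0 by convention. *)
have [->|/set0P A0] := eqVneq A set0; first by rewrite inf0.
by apply: lb_le_inf => // e [/ltW].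
Qed.

Lemma levy_le (F G : R -> R) (e : R) : 0 < e ->
  (forall x, F (x - e) - e <= G x /\ G x <= F (x + e) + e) -> levy F G <= e.
Proof.
move=> e0 FG; apply: ge_inf; last by split.
by exists 0 => z [/ltW].
Qed.

Lemma esd_gram_le m n (S T : 'M[R]_(m, n)) (a e x : R) :
  (0 < n)%N -> 0 <= a -> 0 < e ->
  a * (\sum_i \sum_j (T i j - S i j) ^+ 2) <= e ^+ 4 / 16 * n%:R ->
  a * (\sum_i \sum_j (T i j + S i j) ^+ 2) <= 16 * n%:R ->
  esd (a *: (S^T *m S)) x <= esd (a *: (T^T *m T)) (x + e) + e.
Proof.
move=> n0 a0 e0 hD hE.
have n0' : 0 < n%:R :> R by rewrite ltr0n.
(* The weight s = 4 / e turns each of the two hypotheses into e ^ 2 times n. Their half-sum, divided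
   by the gap e, bounds the difference of counts by e times n. *)
have s0 : 4 / e != 0 by rewrite mulf_neq0 ?invr_eq0 ?gt_eqF.
have xe : x < x + e by rewrite ltrDl.
have := count_spectrum_gram_le S T a0 s0 xe.
rewrite addrAC subrr add0r /esd.
set c1 := (count _ _)%:R; set c2 := (count _ _)%:R.
set D := \sum_i _ in hD *; set E := \sum_i _ in hE *.
move=> h.
have h2 : a * (2^-1 * ((4 / e) ^+ 2 * D + (4 / e) ^- 2 * E)) <= e * (e * n%:R).
  have -> : a * (2^-1 * ((4 / e) ^+ 2 * D + (4 / e) ^- 2 * E)) =
            2^-1 * (16 / e ^+ 2 * (a * D) + e ^+ 2 / 16 * (a * E)).
    by field; rewrite gt_eqF.
  apply: (@le_trans _ _ (2^-1 * (16 / e ^+ 2 * (e ^+ 4 / 16 * n%:R) +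
                                 e ^+ 2 / 16 * (16 * n%:R)))).
    rewrite ler_wpM2l // lerD // ler_wpM2l //.
      by rewrite divr_ge0 // sqr_ge0.
    by rewrite divr_ge0 // sqr_ge0.
  by rewrite le_eqVlt; apply/orP; left; apply/eqP; field; rewrite gt_eqF.
have := le_trans h h2; rewrite ler_pM2l // => h3.
rewrite -lerBlDl -mulrBl ler_pdivrMr //; lra.
Qed.

(** The hypotheses are symmetric in [S] and [T], so the one-sided bound applies both ways: at x - e
    for the lower inequality, and at x with the roles exchanged for the upper one. *)
Lemma levy_esd_gram_le m n (S T : 'M[R]_(m, n)) (a e : R) :
  (0 < n)%N -> 0 <= a -> 0 < e ->
  a * (\sum_i \sum_j (T i j - S i j) ^+ 2) <= e ^+ 4 / 16 * n%:R ->
  a * (\sum_i \sum_j (T i j + S i j) ^+ 2) <= 16 * n%:R ->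
  levy (esd (a *: (S^T *m S))) (esd (a *: (T^T *m T))) <= e.
Proof.
move=> n0 a0 e0 hD hE; apply: levy_le => // x; split.
  by have := esd_gram_le (x - e) n0 a0 e0 hD hE; rewrite subrK lerBlDr.
apply: esd_gram_le => //.
  move: hD; under eq_bigr do under eq_bigr do rewrite -sqrrN opprB.
  by [].
move: hE; under eq_bigr do under eq_bigr do rewrite addrC.
by [].
Qed.

(** The leading 1 in [rank_of] is the term k = i. The rank is therefore n times the empirical
    distribution function at the observation itself. *)
Lemma rank_ofE n p (x : 'I_n -> 'I_p -> R) i j :
  rank_of x i j = (\sum_(k < n) (x k j <= x i j)%R)%N.
Proof.
rewrite /rank_of (bigD1 i) //= lexx; congr (_ + _)%N.
rewrite -sum1_card big_mkcond [RHS]big_mkcond /=; apply: eq_bigr => k _.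
rewrite (_ : (k \in _) = (k != i) && (x k j <= x i j)); last exact: asboolb.
by case: (k != i); case: (x k j <= x i j).
Qed.

Lemma rank_of_bounds n p (x : 'I_n -> 'I_p -> R) i j :
  (1 <= rank_of x i j <= n)%N.
Proof.
rewrite {2}rank_ofE -[X in (_ <= _ <= X)%N]card_ord -sum1_card.
by apply: leq_sum => k _; case: (_ <= _).
Qed.

(** With s the scaling of the ranks, q the root of 3, c = s N / 2 and u = r / N, the entry [T]
    equals c (2 u - 1) - s / 2. Hence S - T splits into the error c - q of the scaling, the
    half-step s / 2 of the centring, and the error u - F. *)
Lemma std_rank_close (N r F delta : R) : 2 <= N -> 1 <= r <= N -> 0 <= F <= 1 ->
  `|r / N - F| <= delta ->
  let T := Num.sqrt (12 / (N ^+ 2 - 1)) * (r - (N + 1) / 2) in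
  let S := Num.sqrt 3 * (2 * F - 1) in
  (S - T) ^+ 2 <= 18 / (N ^+ 2 - 1) + 36 * delta ^+ 2 /\ (S + T) ^+ 2 <= 16.
Proof.
move=> N2 /andP[r1 rN] /andP[F0 F1] hd T S.
have M0 : 0 < N ^+ 2 - 1 by nra.
have s2 : Num.sqrt (12 / (N ^+ 2 - 1)) ^+ 2 = 12 / (N ^+ 2 - 1).
  by rewrite sqr_sqrtr // divr_ge0 // ltW.
have s0 := sqrtr_ge0 (12 / (N ^+ 2 - 1)).
have q2 : Num.sqrt 3 ^+ 2 = 3 :> R by rewrite sqr_sqrtr.
have q0 := sqrtr_ge0 (3 : R).
rewrite /T /S.
move: s2 s0 q2 q0; set s := Num.sqrt _; set q := Num.sqrt _ => s2 s0 q2 q0.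
have sM : s ^+ 2 * (N ^+ 2 - 1) = 12 by rewrite s2 divfK // gt_eqF.
have -> : 18 / (N ^+ 2 - 1) = 3 / 2 * s ^+ 2 by rewrite s2; field; rewrite gt_eqF.
have S3 : (q * (2 * F - 1)) ^+ 2 <= 3.
  rewrite exprMn q2; nra.
have T3 : (s * (r - (N + 1) / 2)) ^+ 2 <= 3.
  have h : (r - (N + 1) / 2) ^+ 2 <= (N - 1) ^+ 2 / 4 by nra.
  have h2 : (N - 1) ^+ 2 <= N ^+ 2 - 1 by nra.
  have := ler_wpM2l (sqr_ge0 s) h; have := ler_wpM2l (sqr_ge0 s) h2.
  rewrite sM exprMn; lra.
split; last first.
  (* By the parallelogram identity the square of S + T is at most twice the sum of the two squares,
     hence at most 12. *)
  have := sqr_ge0 (q * (2 * F - 1) - s * (r - (N + 1) / 2)).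
  nra.
have N0 : N != 0 by rewrite gt_eqF //; lra.
pose u := r / N; pose c := s * N / 2.
have u01 : 0 <= u <= 1.
  rewrite /u divr_ge0 ?ler_pdivrMr; lra.
have c2 : c ^+ 2 = 3 + s ^+ 2 / 4.
  by rewrite /c; move: sM; rewrite expr_div_n exprMn; lra.
have qc : q <= c.
  rewrite -(@ler_pXn2r _ 2) ?nnegrE //; last by rewrite /c; nra.
  rewrite c2 q2; have := sqr_ge0 s; lra.
(* Since c is at least q, the square of c - q is at most the difference of the squares of c and q,
   which is s ^ 2 / 4. *)
have cq : (c - q) ^+ 2 <= s ^+ 2 / 4.
  have : 0 <= q * (c - q) by rewrite mulr_ge0 // subr_ge0.
  rewrite sqrrB c2 q2; have : q * q = 3 by rewrite -expr2.
  lra.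
have -> : q * (2 * F - 1) - s * (r - (N + 1) / 2) =
    - ((c - q) * (2 * u - 1) + (- (s / 2)) + 2 * q * (u - F)).
  by rewrite /c /u; field.
rewrite sqrrN.
have d2 : (u - F) ^+ 2 <= delta ^+ 2.
  rewrite -[leLHS]real_normK ?num_real // lerXn2r ?nnegrE //.
  exact: le_trans hd.
have h3 (A B E : R) : (A + B + E) ^+ 2 <= 3 * (A ^+ 2 + B ^+ 2 + E ^+ 2).
  have := sqr_ge0 (A - B); have := sqr_ge0 (A - E); have := sqr_ge0 (B - E); nra.
apply: (le_trans (h3 _ _ _)).
have a1 : ((c - q) * (2 * u - 1)) ^+ 2 <= s ^+ 2 / 4.
  rewrite exprMn; apply: le_trans cq.
  rewrite ler_piMr ?sqr_ge0 //.
  move: u01 => /andP[u0 u1]; nra.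
have a3 : (2 * q * (u - F)) ^+ 2 <= 12 * delta ^+ 2.
  rewrite !exprMn q2; lra.
have a2 : (- (s / 2)) ^+ 2 = s ^+ 2 / 4 by rewrite sqrrN expr_div_n; lra.
rewrite a2; lra.
Qed.

Lemma levy_spearman_Wmat_le n p (F : 'I_n -> 'I_p -> R -> R) (x : 'I_n -> 'I_p -> R)
    (delta e : R) :
  (2 <= n)%N -> (0 < p)%N -> 0 < e ->
  18 / (n%:R ^+ 2 - 1) + 36 * delta ^+ 2 <= e ^+ 4 / 16 ->
  (forall i j, 0 <= F i j (x i j) <= 1) ->
  (forall i j, `|(rank_of x i j)%:R / n%:R - F i j (x i j)| <= delta) ->
  levy (esd (spearman x)) (esd (Wmat F x)) <= e.
Proof.
move=> n2 p0 e0 he F01 hF.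
(* Absorbing the root of 3 into the entries makes [Wmat] a Gram matrix with the same factor 1 / n as
   [spearman]. *)
pose S : 'M[R]_(n, p) := \matrix_(i, j) (Num.sqrt 3 * (2 * F i j (x i j) - 1)).
have n0 : 0 < n%:R :> R by rewrite ltr0n (leq_trans _ n2).
have -> : Wmat F x = n%:R^-1 *: (S^T *m S).
  rewrite /Wmat mulrC -scalerA; congr (_ *: _).
  apply/matrixP => i j; rewrite !mxE summxE mulr_sumr; apply: eq_bigr => k _.
  rewrite !mxE big_ord1 !mxE.
  rewrite mulrACA -expr2 sqr_sqrtr //.
have close i j := @std_rank_close n%:R (rank_of x i j)%:R (F i j (x i j)) delta.
have close' i j : (S i j - std_rank_mx x i j) ^+ 2 <= e ^+ 4 / 16 /\
                  (S i j + std_rank_mx x i j) ^+ 2 <= 16.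
  rewrite !mxE.
  have [||//|//|h1 h2] := close i j.
  - by rewrite ler_nat.
  - by rewrite ler1n ler_nat rank_of_bounds.
  by split => //; apply: le_trans he.
have bound (G : 'I_n -> 'I_p -> R) b : (forall i j, G i j <= b) ->
    n%:R^-1 * (\sum_i \sum_j G i j) <= b * p%:R.
  move=> Gb; rewrite mulrC ler_pdivrMr //.
  apply: (@le_trans _ _ (\sum_(i < n) \sum_(j < p) b)).
    by apply: ler_sum => i _; apply: ler_sum => j _.
  by rewrite !sumr_const !card_ord !mulr_natr.
apply: levy_esd_gram_le => //.
- by apply: bound => i j; case: (close' i j).
- by apply: bound => i j; case: (close' i j).
Qed.

End Levy.

(** * Concentration of empirical distribution functions *)

Section Concentration.
Context d (T : measurableType d) (R : realType) (P : probability T R).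

Definition independent_events n (E : 'I_n -> set T) :=
  forall S : {set 'I_n},
    P [set w | forall k, k \in S -> E k w] = (\prod_(k in S) P (E k))%E.

(** Expanding the product over subsets reduces its expectation to probabilities of intersections,
    which is what [independent_events] supplies. *)
Lemma prod_1D_indic n (E : 'I_n -> set T) (b : R) w :
  \prod_(k < n) (1 + b * \1_(E k) w) =
  \sum_(S : {set 'I_n}) b ^+ #|S| * \1_[set w | forall k, k \in S -> E k w] w.
Proof.
under eq_bigr do rewrite addrC.
rewrite bigA_distr; apply: eq_bigr => S _.
rewrite -big_mkcond big_split /= prodr_const; congr (_ * _).
have [wS|nS] := pselect (forall k, k \in S -> E k w).
  rewrite indicE mem_set // big1 // => k kS.
  by rewrite indicE mem_set //; exact: wS.
rewrite indicE memNset //.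
have /existsNP[k /not_implyP[kS nE]] := nS.
by rewrite (bigD1 k) //= indicE memNset // mul0r.
Qed.

Lemma integral_prod_1D_indic n (E : 'I_n -> set T) (b q : R) :
  0 <= b -> (forall k, measurable (E k)) -> independent_events E ->
  (forall k, P (E k) = q%:E) ->
  (\int[P]_w (\prod_(k < n) (1 + b * \1_(E k) w))%:E = ((1 + b * q) ^+ n)%:E)%E.
Proof.
move=> b0 mE iE PE.
pose A (S : {set 'I_n}) := [set w | forall k, k \in S -> E k w].
have mA S : measurable (A S).
  rewrite (_ : A S = \bigcap_(k in [set k | k \in S]) E k) //.
  by apply: fin_bigcap_measurable => // k _; exact: mE.
under eq_integral do rewrite prod_1D_indic -sumEFin.
rewrite ge0_integral_sum //=; last 2 first.
- move=> S; apply/measurable_EFinP; apply: measurable_funM => //.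
  exact/measurable_indic/mA.
- by move=> S w _; rewrite lee_fin mulr_ge0 ?exprn_ge0.
(* The power is expanded over the same subsets, so that the two sums can be compared term by
   term. *)
have -> : (1 + b * q) ^+ n = \sum_(S : {set 'I_n}) b ^+ #|S| * q ^+ #|S|.
  rewrite -[in LHS](card_ord n) -prodr_const.
  under eq_bigr do rewrite addrC.
  rewrite bigA_distr; apply: eq_bigr => S _.
  by rewrite -big_mkcond prodr_const exprMn.
rewrite -sumEFin; apply: eq_bigr => S _.
under eq_integral do rewrite EFinM.
rewrite ge0_integralZl //=; last 2 first.
- exact/measurable_EFinP/measurable_indic/mA.
- by rewrite lee_fin exprn_ge0.
rewrite integral_indic ?setIT //; last exact: mA.
rewrite EFinM; congr (_ * _)%E.
apply: (eq_trans (iE S)); rewrite (eq_bigr (fun=> q%:E)) => [|k _]; last exact: PE.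
by rewrite prodEFin prodr_const.
Qed.

(** From 1 - r <= exp (- r) one gets exp r <= 1 / (1 - r), and (1 - r) (1 + r + 2 r ^ 2) = 1 + r ^ 2
    (1 - 2 r) is at least 1 on this range. *)
Lemma expR_le_quadratic (r : R) : 0 <= r <= 1 / 2 -> expR r <= 1 + r + 2 * r ^+ 2.
Proof.
move=> /andP[r0 r2].
have h : 1 - r <= expR (- r) := expR_ge1Dx _.
have r1 : 0 < 1 - r by lra.
have : expR r <= (1 - r)^-1.
  by rewrite -[expR r]invrK -expRN lef_pV2 ?posrE ?expR_gt0.
move/le_trans; apply; rewrite -div1r ler_pdivrMr //; nra.
Qed.

(** Chernoff's bound: exp (r 1_E) = 1 + b 1_E with b = exp r - 1, so the exponential moment of the
    sum is the product computed above. *)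
Lemma independent_events_upper_tail n (E : 'I_n -> set T) (q delta : R) :
  0 < delta <= 1 -> (forall k, measurable (E k)) -> independent_events E ->
  (forall k, P (E k) = q%:E) ->
  (P [set w | (n%:R * (q + delta) <= \sum_(k < n) \1_(E k) w)%R]
    <= (expR (- (n%:R * (delta ^+ 2 / 8))))%:E)%E.
Proof.
move=> /andP[d0 d1] mE iE PE.
set A := [set w | _].
have mS : measurable_fun [set: T] (fun w => \sum_(k < n) \1_(E k) w : R).
  by apply: measurable_sum => k; exact: measurable_indic.
have mA : measurable A.
  rewrite -[A]setTI; exact: measurable_fun_le.
(* Without events nothing places [q] in [0, 1]; the bound is then exp 0 = 1. *)
have [n0|n0] := posnP n.
  apply: (le_trans (probability_le1 P mA)).
  by rewrite n0 mul0r oppr0 expR0.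
have /andP[q0 q1] : 0 <= q <= 1.
  rewrite -!lee_fin -(PE (Ordinal n0)); apply/andP; split; first exact: measure_ge0.
  exact: probability_le1.
(* This r minimizes the exponent 2 r ^ 2 - r delta, giving - delta ^ 2 / 8, and stays within the
   range of [expR_le_quadratic]. *)
pose r := delta / 4; pose b := expR r - 1; pose c := n%:R * (q + delta).
have r0 : 0 < r by rewrite divr_gt0.
have b0 : 0 <= b by rewrite subr_ge0 -expR0 ler_expR ltW.
have key w : \1_A w <= expR (- (r * c)) * \prod_(k < n) (1 + b * \1_(E k) w).
  have -> : \prod_(k < n) (1 + b * \1_(E k) w) = expR (r * \sum_(k < n) \1_(E k) w).
    rewrite mulr_sumr expR_sum; apply: eq_bigr => k _.
    rewrite indicE /b; case: (w \in _); rewrite /= ?mulr1 ?mulr0 ?expR0; lra.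
  rewrite -expRD indicE; case: (boolP (w \in A)) => wA; last exact: expR_ge0.
  rewrite -expR0 ler_expR addrC subr_ge0 ler_pM2l //.
  by move: wA; rewrite inE.
have -> : P A = (\int[P]_w (\1_A w)%:E)%E by rewrite integral_indic // setIT.
apply: (@le_trans _ _ (\int[P]_w (expR (- (r * c)) * \prod_(k < n) (1 + b * \1_(E k) w))%:E)%E).
  have mprod : measurable_fun [set: T] (fun w => \prod_(k < n) (1 + b * \1_(E k) w)).
    apply: measurable_prod => k _; apply: measurable_funD => //.
    by apply: measurable_funM => //; exact: measurable_indic.
  apply: ge0_le_integral => //=.
  - by apply/measurable_EFinP; exact: measurable_indic.
  - by apply/measurable_EFinP; exact: measurable_funM.
  - by move=> w _; rewrite lee_fin.
under eq_integral do rewrite EFinM.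
rewrite ge0_integralZl //=; last 2 first.
- apply/measurable_EFinP; apply: measurable_prod => k _; apply: measurable_funD => //.
  by apply: measurable_funM => //; exact: measurable_indic.
- by move=> w _; rewrite lee_fin prodr_ge0 // => k _; rewrite addr_ge0 // mulr_ge0.
rewrite (integral_prod_1D_indic b0 mE iE PE) -EFinM lee_fin.
apply: (@le_trans _ _ (expR (- (r * c)) * expR (q * r + 2 * r ^+ 2) ^+ n)).
  rewrite ler_wpM2l ?expR_ge0 // lerXn2r ?nnegrE ?expR_ge0 //.
    by rewrite addr_ge0 // mulr_ge0.
  apply: le_trans (expR_ge1Dx _); rewrite lerD2l.
  have := @expR_le_quadratic r; rewrite /b => h.
  have {}h : expR r - 1 <= r + 2 * r ^+ 2.
    by rewrite lerBlDl addrA; apply: h; rewrite ltW //= /r; lra.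
  apply: (le_trans (ler_wpM2r q0 h)); have := sqr_ge0 r; nra.
rewrite -expRM_natl -expRD ler_expR le_eqVlt; apply/orP; left; apply/eqP.
by rewrite /c /r; field.
Qed.

End Concentration.

(** * Pointwise deviation of empirical distribution functions, and the passage from a quantile grid
    to all points *)

Section GlivenkoCantelli.
Context d (T : measurableType d) (R : realType) (P : probability T R).

(** A subfamily is handled by taking the whole space for the indices outside [S]. *)
Lemma independent_events_marginal n p (Y : 'I_n -> T -> ('I_p -> R)) j (B : set R) :
  mutually_independent P Y -> measurable B ->
  independent_events P (fun k => [set w | B (Y k w j)]).
Proof.
move=> iY mB S.
pose A k : set ('I_p -> R) := if k \in S then [set v | B (v j)] else setT.
have bA k : borel_vec (A k).
  apply: sub_sigma_algebra; rewrite /A; case: (k \in S).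
    exists (fun i => if i == j then B else setT).
      by move=> i /=; case: (i == j).
    apply/seteqP; split => v /=; first by move/(_ j); rewrite eqxx.
    by move=> Bv i; case: eqP => // ->.
  by exists (fun=> setT) => //; apply/seteqP; split.
have := iY A bA.
rewrite (_ : \bigcap_(i in _) _ = [set w | forall k, k \in S -> B (Y k w j)]).
  move=> ->; rewrite [RHS]big_mkcond /=; apply: eq_bigr => k _.
  by rewrite /A; case: (k \in S) => //; rewrite preimage_setT probability_setT.
apply/seteqP; split => w /=.
  by move=> h k kS; have := h k I; rewrite /A kS.
by move=> h k _; rewrite /preimage /A /=; case: ifP => // /h.
Qed.

Lemma marginal_identically_distributed n p (Y : 'I_n -> T -> ('I_p -> R)) i k j (B : set R) :
  identically_distributed P Y -> measurable B ->
  P [set w | B (Y i w j)] = P [set w | B (Y k w j)].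
Proof.
move=> idY mB; apply: (idY i k [set v | B (v j)]).
apply: sub_sigma_algebra; exists (fun l => if l == j then B else setT).
  by move=> l /=; case: (l == j).
apply/seteqP; split => v /=; first by move/(_ j); rewrite eqxx.
by move=> Bv l; case: eqP => // ->.
Qed.

Lemma measurable_sublevel (Z : T -> R) (x : R) :
  measurable_fun setT Z -> measurable [set w | Z w <= x].
Proof.
move=> mZ; have mB : measurable [set r : R | r <= x] by rewrite -set_itvNyc.
by have := mZ measurableT _ mB; rewrite setTI.
Qed.

Definition ecdf n p (Y : 'I_n -> T -> ('I_p -> R)) j w (x : R) : R :=
  (\sum_(k < n) (Y k w j <= x)%R)%:R / n%:R.

(** The lower tail is the upper tail of the complementary events, which have probability 1 - F; the
    two tails account for the factor 2. *)
Lemma ecdf_deviation n p (Y : 'I_n -> T -> ('I_p -> R)) i j (q delta : R) :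
  (forall k, random_vector (Y k)) -> mutually_independent P Y ->
  identically_distributed P Y -> 0 < delta <= 1 ->
  exists2 A, measurable A /\ (P A <= (2 * expR (- (n%:R * (delta ^+ 2 / 8))))%:E)%E &
    forall w, ~ A w -> `|ecdf Y j w q - dist_fun P (fun v => Y i v j) q| <= delta.
Proof.
move=> rY iY idY d01.
have n0 : 0 < n%:R :> R by rewrite ltr0n; exact: leq_ltn_trans (leq0n i) (ltn_ord i).
set F := dist_fun P _ q.
pose E k := [set w | Y k w j <= q].
pose E' k := [set w | q < Y k w j].
have mB : measurable [set x : R | x <= q] by rewrite -set_itvNyc.
have mB' : measurable [set x : R | q < x] by rewrite -set_itvoy.
have mE k : measurable (E k) := measurable_sublevel q (rY k j).
have mE' k : measurable (E' k).
  by have := rY k j measurableT _ mB'; rewrite setTI.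
have iE : independent_events P E := independent_events_marginal j iY mB.
have iE' : independent_events P E' := independent_events_marginal j iY mB'.
have PE k : P (E k) = F%:E.
  rewrite /F /dist_fun fineK ?fin_num_measure //; last exact: mE.
  exact: (@marginal_identically_distributed n p Y k i j _ idY mB).
have PE' k : P (E' k) = (1 - F)%:E.
  have -> : E' k = ~` E k.
    by apply/seteqP; split => w /=; rewrite /E /E' /= ltNge => /negP.
  by rewrite probability_setC // PE.
have h := independent_events_upper_tail d01 mE iE PE.
have h' := independent_events_upper_tail d01 mE' iE' PE'.
set U := [set w | _] in h; set U' := [set w | _] in h'.
have mU (D : 'I_n -> set T) c : (forall k, measurable (D k)) ->
    measurable [set w | (c <= \sum_(k < n) \1_(D k) w :> R)%R].
  move=> mD; rewrite -[X in measurable X]setTI; apply: measurable_fun_le => //.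
  by apply: measurable_sum => k; exact: measurable_indic.
exists (U `|` U').
  split; first by apply: measurableU; exact: mU.
  have := measureU2 P (mU _ _ mE : measurable U) (mU _ _ mE' : measurable U').
  move/le_trans; apply.
  rewrite (_ : 2 * _ = expR (- (n%:R * (delta ^+ 2 / 8))) + expR (- (n%:R * (delta ^+ 2 / 8)))); last by ring.
  by rewrite EFinD; apply: leeD.
move=> w /not_orP[/negP nU /negP nU'].
have sE : \sum_(k < n) \1_(E k) w = (\sum_(k < n) (Y k w j <= q)%R)%:R :> R.
  rewrite natr_sum; apply: eq_bigr => k _; rewrite indicE; congr (nat_of_bool _)%:R.
  exact: asboolb.
have sE' : \sum_(k < n) \1_(E' k) w = n%:R - \sum_(k < n) \1_(E k) w :> R.
  apply/eqP; rewrite eq_sym subr_eq -big_split /=.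
  rewrite -[in n%:R](card_ord n) -sum1_card natr_sum; apply/eqP; apply: eq_bigr => k _.
  rewrite !indicE (_ : (w \in E' k) = (q < Y k w j)); last exact: asboolb.
  rewrite (_ : (w \in E k) = (Y k w j <= q)); last exact: asboolb.
  by case: ltP => _; rewrite ?addr0 ?add0r.
move: nU nU'; rewrite /U /U' /= sE' sE -!ltNge => hU hU'.
rewrite /ecdf; set s := (_ %:R : R) in hU hU' *.
rewrite ler_norml lerBrDr lerBlDr.
rewrite ler_pdivlMr // ler_pdivrMr //; apply/andP; split; nra.
Qed.

Lemma dist_fun_quantile (Z : T -> R) (t : R) :
  measurable_fun setT Z -> continuous (dist_fun P Z : R -> R) -> 0 < t < 1 ->
  exists q, dist_fun P Z q = t.
Proof.
move=> mZ cZ /andP[t0 t1].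
pose Z' : {RV P >-> R} := HB.pack Z (isMeasurableFun.Build _ _ _ _ Z mZ).
have FE : dist_fun P Z = fine \o cdf Z'.
  by apply/funext => x; rewrite /dist_fun /cdf /distribution /pushforward /= set_itvNyc.
have y1 : dist_fun P Z x @[x --> +oo] --> (1 : R).
  by rewrite FE; exact/fine_cvg/cvg_cdfy1.
have y0 : dist_fun P Z x @[x --> -oo] --> (0 : R).
  by rewrite FE; exact/fine_cvg/cvg_cdfNy0.
have [M [_ hM]] := cvgr_lt _ y0 _ t0.
have [N [_ hN]] := cvgr_gt _ y1 _ t1.
(* Both limits give strict half-lines; the minimum with N keeps a <= b for the intermediate value
   theorem. *)
pose a := Num.min (M - 1) N; pose b := N + 1.
have Fa : dist_fun P Z a < t by apply: hM; rewrite gt_min ltrBlDr ltrDl ltr01.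
have Fb : t < dist_fun P Z b by apply: hN; rewrite ltrDl.
have ab : a <= b by rewrite ge_min lerDl ler01 orbT.
have [//|||c _ Fc] := @IVT _ (dist_fun P Z) a b t.
- exact: continuous_subspaceT.
- by rewrite ge_min le_max (ltW Fa) (ltW Fb) orbT.
by exists c.
Qed.

Lemma dist_fun_ge0_le1 (Z : T -> R) x : measurable_fun setT Z -> 0 <= dist_fun P Z x <= 1.
Proof.
move=> mZ; have mE := measurable_sublevel x mZ.
rewrite /dist_fun fine_ge0 //= -lee_fin fineK ?fin_num_measure //.
exact: probability_le1.
Qed.

Lemma dist_fun_nondecreasing (Z : T -> R) : measurable_fun setT Z ->
  {homo dist_fun P Z : x y / x <= y}.
Proof.
move=> mZ x y xy.
have mE z := measurable_sublevel z mZ.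
rewrite /dist_fun fine_le ?fin_num_measure //.
by apply: le_measure; rewrite ?inE // => w /= /le_trans; apply.
Qed.

(** Monotonicity traps [G x] between its values at neighbouring grid points, where it is within
    [delta] of [F]. At most two grid steps are lost. *)
Lemma nondecreasing_grid_close (F G : R -> R) m (q : nat -> R) (delta : R) :
  (0 < m)%N -> 0 <= delta -> {homo F : x y / x <= y} -> {homo G : x y / x <= y} ->
  (forall x, 0 <= F x <= 1) -> (forall x, 0 <= G x <= 1) ->
  (forall l, (0 < l < m)%N -> F (q l) = l%:R / m%:R /\ `|G (q l) - F (q l)| <= delta) ->
  forall x, `|G x - F x| <= delta + 2 / m%:R.
Proof.
move=> m0 d0 Fm Gm F01 G01 hq x.
have m0' : 0 < m%:R :> R by rewrite ltr0n.
have /andP[Fx0 Fx1] := F01 x; have /andP[Gx0 Gx1] := G01 x.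
(* The lower bound uses q (l - 1) and not q l, which may exceed x when F is flat. *)
pose l := Num.truncn (m%:R * F x).
have /andP[l1 l2] : l%:R <= m%:R * F x < l.+1%:R.
  by apply: truncn_itv; rewrite mulr_ge0.
have im : 0 < m%:R^-1 :> R by rewrite invr_gt0.
have mi : m%:R * m%:R^-1 = 1 :> R by rewrite divff // gt_eqF.
have {}l1 : l%:R / m%:R <= F x by rewrite ler_pdivrMr // mulrC.
have {}l2 : F x < l.+1%:R / m%:R by rewrite ltr_pdivlMr // mulrC.
have l2' : F x < l%:R / m%:R + m%:R^-1 by move: l2; rewrite -natr1 mulrDl mul1r.
rewrite ler_norml; apply/andP; split.
  (* No usable grid point lies to the left, but F x < 2 / m and [G x] is nonnegative. *)
  have [l3|l3] := leqP l 1.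
    have : l%:R / m%:R <= m%:R^-1 :> R by rewrite -[leRHS]mul1r ler_pM2r // lern1.
    lra.
  have lm : (l.-1 < m)%N.
    rewrite -(ltr_nat R) -(ltr_pM2r im) mi; apply: lt_le_trans Fx1.
    by apply: lt_le_trans l1; rewrite ltr_pM2r // ltr_nat prednK // (ltn_trans _ l3).
  have [|Fq Gq] := hq l.-1; first by rewrite lm andbT -ltnS prednK // (ltn_trans _ l3).
  have El : l.-1%:R = l%:R - 1 :> R by rewrite -[in RHS](@prednK l) ?(ltn_trans _ l3) // -natr1 addrK.
  have qx : q l.-1 <= x.
    rewrite leNgt; apply/negP => /ltW /Fm; rewrite Fq El mulrBl mul1r; lra.
  have := Gm _ _ qx; move: Gq; rewrite Fq El mulrBl mul1r ler_norml => /andP[]; lra.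
(* At the right end F x is at least 1 - 1 / m, and [G x] is at most 1. *)
have [l3|l3] := leqP m l.+1.
  have : 1 <= l%:R / m%:R + m%:R^-1 :> R.
    by rewrite -[X in _ + X]mul1r -mulrDl natr1 ler_pdivlMr // mul1r ler_nat.
  lra.
have [//|Fq Gq] := hq l.+1.
have qx : x <= q l.+1.
  by rewrite leNgt; apply/negP => /ltW /Fm; rewrite Fq leNgt l2.
have := Gm _ _ qx; move: Gq; rewrite Fq -natr1 mulrDl mul1r ler_norml => /andP[]; lra.
Qed.

End GlivenkoCantelli.

(** * Almost sure uniform closeness *)

Section Uniform.
Context d (T : measurableType d) (R : realType) (P : probability T R).

Lemma measure_bigsetU_le (I : finType) (A : I -> set T) (b : R) :
  (forall i, measurable (A i)) -> (forall i, (P (A i) <= b%:E)%E) ->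
  (P (\big[setU/set0]_i A i) <= (#|I|%:R * b)%:E)%E.
Proof.
move=> mA Pb.
have -> : #|I|%:R * b = \sum_(i : I) b by rewrite sumr_const mulr_natl.
rewrite -sumEFin.
(* Measurability is carried along in the induction because subadditivity for two sets requires
   it. *)
have [] : measurable (\big[setU/set0]_i A i) /\
    (P (\big[setU/set0]_i A i) <= \sum_(i : I) b%:E)%E => //.
apply: (big_ind2 (fun U s => measurable U /\ (P U <= s)%E)).
- by rewrite measure0.
- move=> U s V t [mU Us] [mV Vt]; split; first exact: measurableU.
  by apply: (le_trans (measureU2 P mU mV)); exact: leeD.
- by move=> i _; split.
Qed.

(** A union bound over p coordinates and m grid indices. Uniformity in x matters because the
    functions are later evaluated at the random observations. *)
Lemma ecdf_uniform_deviation n p (Y : 'I_n -> T -> ('I_p -> R)) (delta : R) m :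
  (0 < n)%N -> (0 < m)%N ->
  (forall k, random_vector (Y k)) -> mutually_independent P Y ->
  identically_distributed P Y ->
  (forall i j, continuous (dist_fun P (fun w => Y i w j) : R -> R)) ->
  0 < delta <= 1 ->
  exists2 A, measurable A /\
     (P A <= (p%:R * m%:R * (2 * expR (- (n%:R * (delta ^+ 2 / 8)))))%:E)%E &
    forall w, ~ A w -> forall i j x,
      `|ecdf Y j w x - dist_fun P (fun v => Y i v j) x| <= delta + 2 / m%:R.
Proof.
move=> n0 m0 rY iY idY cY d01.
pose i0 := Ordinal n0.
pose F j := dist_fun P (fun v => Y i0 v j).
have n0' : 0 < n%:R :> R by rewrite ltr0n.
have FE i j : dist_fun P (fun v => Y i v j) = F j.
  apply/funext => x; rewrite /F /dist_fun.
  have mB : measurable [set r : R | r <= x] by rewrite -set_itvNyc.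
  by rewrite (@marginal_identically_distributed _ _ _ P n p Y i i0 j _ idY mB).
(* Continuity provides the quantiles at the interior levels l / m; elsewhere the value 0 is a mere
   default. *)
have /choice[q qE] : forall jl : 'I_p * nat, exists x : R,
    (0 < jl.2 < m)%N -> F jl.1 x = jl.2%:R / m%:R.
  move=> [j l] /=; case: (boolP (0 < l < m)%N) => [/andP[l0 lm]|_]; last by exists 0.
  have [|||x Fx] := @dist_fun_quantile _ T R P (fun v => Y i0 v j) (l%:R / m%:R).
  - exact: rY.
  - exact: cY.
  - by rewrite divr_gt0 ?ltr0n // ltr_pdivrMr ?ltr0n // mul1r ltr_nat.
  by exists x.
have /choice[A hA] : forall jl : 'I_p * 'I_m, exists A,
    (measurable A /\ (P A <= (2 * expR (- (n%:R * (delta ^+ 2 / 8))))%:E)%E) /\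
    forall w, ~ A w -> `|ecdf Y jl.1 w (q (jl.1, val jl.2)) - F jl.1 (q (jl.1, val jl.2))| <= delta.
  move=> [j l] /=.
  by have [A h1 h2] := ecdf_deviation i0 j (q (j, val l)) rY iY idY d01; exists A.
exists (\big[setU/set0]_jl A jl).
  split; first by apply: bigsetU_measurable => jl _; case: (hA jl) => [[]].
  have -> : p%:R * m%:R = #|{: 'I_p * 'I_m}|%:R :> R.
    by rewrite card_prod !card_ord natrM.
  by apply: measure_bigsetU_le => jl; case: (hA jl) => [[]].
move=> w nA i j x; rewrite FE.
have dge0 : 0 <= delta by case/andP: d01 => /ltW.
apply: (@nondecreasing_grid_close R (F j) (ecdf Y j w) m (fun l => q (j, l))) => //.
- by apply: dist_fun_nondecreasing; exact: rY.
- move=> u v uv; rewrite /ecdf ler_pM2r ?invr_gt0 // ler_nat.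
  apply: leq_sum => k _; case: (boolP (Y k w j <= u)) => // h.
  by rewrite (le_trans h uv).
- by move=> u; apply: dist_fun_ge0_le1; exact: rY.
- move=> u; rewrite /ecdf divr_ge0 //= ler_pdivrMr // mul1r ler_nat.
  by rewrite -[leqRHS](card_ord n) -sum1_card; apply: leq_sum => k _; case: (_ <= _).
- move=> l lm; split; first exact: (qE (j, l)).
  have lm' : (l < m)%N by case/andP: lm.
  have [_ h] := hA (j, Ordinal lm'); apply: h => hw; apply: nA.
  by rewrite (bigD1 (j, Ordinal lm')) //=; left.
Qed.

Lemma borel_cantelli_geometric (A : nat -> set T) (K r : R) :
  0 < r < 1 -> (forall n, measurable (A n)) ->
  (forall n, (P (A n) <= (K * r ^+ n)%:E)%E) ->
  {ae P, forall w, exists N, forall n, (N <= n)%N -> ~ A n w}.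
Proof.
move=> /andP[r0 r1] mA PA.
(* The negligible set is the limsup of the [A n], null by the first Borel-Cantelli lemma. *)
exists (lim_sup_set A); split.
- by apply: bigcap_measurable => // n _; apply: bigcup_measurable => k _.
- apply: lim_sup_set_cvg0 => //.
  have cv : cvgn (series (geometric K r)).
    by apply: is_cvg_geometric_series; rewrite gtr0_norm.
  apply: (@le_lt_trans _ _ (limn (series (geometric K r)))%:E); last exact: ltry.
  rewrite -EFin_lim //.
  apply: (@le_trans _ _ (\sum_(n <oo) (K * r ^+ n)%:E)%E).
    by apply: lee_nneseries => [n _ _|n _]; [exact: measure_ge0|exact: PA].
  rewrite le_eqVlt; apply/orP; left; apply/eqP; congr (limn _).
  by apply/funext => n /=; rewrite /series /= sumEFin.
- move=> w /= h n _; apply: contrapT => hn; apply: h; exists n => k nk Ak.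
  by apply: hn; exists k.
Qed.

Lemma ae_eventually_ranks_close (p : nat -> nat)
    (X : forall n : nat, 'I_n -> T -> ('I_(p n) -> R)) (y delta : R) :
  (forall n i, random_vector (X n i)) ->
  (forall n, mutually_independent P (X n)) ->
  (forall n, identically_distributed P (X n)) ->
  (forall n (i : 'I_n) (j : 'I_(p n)), continuous (dist_fun P (fun w => X n i w j) : R -> R)) ->
  0 < y ->
  (fun n => (p n)%:R / n%:R : R) @ \oo --> y ->
  0 < delta <= 1 ->
  {ae P, forall w, exists N, forall n, (N <= n)%N -> forall i j,
    `|(rank_of (fun i j => X n i w j) i j)%:R / n%:R -
      dist_fun P (fun v => X n i v j) (X n i w j)| <= delta}.
Proof.
move=> rX iX idX cX y0 py /andP[d0 d1].
(* The tolerance is halved: delta / 2 for the grid spacing and delta / 2 for the deviation at grid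
   points. *)
pose m := (Num.truncn (4 / delta)).+1.
have m4 : 2 / m%:R <= delta / 2.
  have : 4 / delta <= m%:R by apply/ltW; exact: truncnS_gt.
  rewrite ler_pdivrMr // => h.
  rewrite ler_pdivrMr ?ltr0n //; lra.
(* The prefactor p n = O(n) is absorbed by half of the exponential decay. *)
pose c := (delta / 2) ^+ 2 / 8.
have c0 : 0 < c by rewrite divr_gt0 // exprn_gt0 // divr_gt0.
pose K := (y + 1) * m%:R * 2 * (2 / c); pose r := expR (- (c / 2)).
have K0 : 0 <= K.
  by rewrite !mulr_ge0 // ?invr_ge0 ?(ltW c0) // addr_ge0 // ltW.
have r01 : 0 < r < 1 by rewrite expR_gt0 expR_lt1 oppr_lt0 divr_gt0.
have [N0 _ hN0] := cvgr_le _ py _ (ltr_pwDr ltr01 (lexx y)).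
have bound n : (N0 <= n)%N -> (0 < n)%N ->
    (p n)%:R * m%:R * (2 * expR (- (n%:R * c))) <= K * r ^+ n.
  move=> /hN0 /= h n0; have n0' : 0 < n%:R :> R by rewrite ltr0n.
  have {}h : (p n)%:R <= (y + 1) * n%:R by rewrite -ler_pdivrMr.
  have hr : expR (- (n%:R * c)) = r ^+ n * r ^+ n.
    by rewrite /r -expRM_natl -expRD; congr expR; field.
  (* This is n c / 2 <= exp (n c / 2), rearranged. *)
  have hn : n%:R * r ^+ n <= 2 / c.
    rewrite /r -expRM_natl mulrN expRN ler_pdivrMr ?expR_gt0 //.
    apply: (@le_trans _ _ (2 / c * (n%:R * (c / 2)))).
      by rewrite le_eqVlt; apply/orP; left; apply/eqP; field; rewrite gt_eqF.
    rewrite (ler_pM2l (divr_gt0 _ c0)) //; apply: le_trans (expR_ge1Dx _).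
    by rewrite lerDr.
  rewrite hr /K.
  apply: (@le_trans _ _ ((y + 1) * n%:R * m%:R * (2 * (r ^+ n * r ^+ n)))).
    rewrite ler_wpM2r ?ler_wpM2r // mulr_ge0 // mulr_ge0 // exprn_ge0 //;
      by case/andP: r01 => /ltW.
  have -> : (y + 1) * n%:R * m%:R * (2 * (r ^+ n * r ^+ n)) =
     (y + 1) * m%:R * 2 * r ^+ n * (n%:R * r ^+ n) by ring.
  rewrite [leRHS]mulrAC ler_wpM2l // !mulr_ge0 //.
    by rewrite addr_ge0 // ltW.
  by rewrite exprn_ge0 //; case/andP: r01 => /ltW.
have d01 : 0 < delta / 2 <= 1 by apply/andP; split; lra.
(* For the finitely many small n the empty set is chosen and the guards make the deviation claim
   vacuous, so the geometric bound holds for all n. *)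
have /choice[A hA] : forall n, exists A, [/\ measurable A, (P A <= (K * r ^+ n)%:E)%E &
    forall w, ~ A w -> (N0 <= n)%N -> (0 < n)%N -> forall i j x,
      `|ecdf (X n) j w x - dist_fun P (fun v => X n i v j) x| <= delta].
  move=> n; have [/andP[nN n0]|nn] := boolP ((N0 <= n) && (0 < n))%N.
    have [A [mA PA] h] := ecdf_uniform_deviation n0 (ltn0Sn _ : (0 < m)%N)
      (rX n) (iX n) (idX n) (cX n) d01.
    exists A; split => //.
      by apply: (le_trans PA); rewrite lee_fin; exact: bound.
    move=> w nA _ _ i j x; apply: (le_trans (h w nA i j x)).
    by rewrite [leRHS](splitr delta) lerD2l.
  exists set0; split => //.
    rewrite measure0 lee_fin mulr_ge0 // exprn_ge0 //; by case/andP: r01 => /ltW.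
  by move=> w _ nN n0; move: nn; rewrite nN n0.
have bc := @borel_cantelli_geometric A K r r01 _ _.
have {bc} : {ae P, forall w, exists N, forall n, (N <= n)%N -> ~ A n w}.
  by apply: bc => n; case: (hA n).
apply: filterS => w [N hN]; exists (maxn N (maxn N0 1)) => n.
rewrite !geq_max => /and3P[nN nN0 n0] i j.
have [_ _ h] := hA n.
have := h w (hN n nN) nN0 n0 i j (X n i w j).
by rewrite /ecdf rank_ofE.
Qed.

End Uniform.

Theorem theorem2 (d : measure_display) (T : measurableType d) (R : realType)
  (P : probability T R) (p : nat -> nat)
  (X : forall n : nat, 'I_n -> T -> ('I_(p n) -> R)) (y : R) :
  (forall n i, random_vector (X n i)) ->
  (forall n, mutually_independent P (X n)) ->
  (forall n, identically_distributed P (X n)) ->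
  (forall n (i : 'I_n) (j : 'I_(p n)), continuous (dist_fun P (fun w => X n i w j) : R -> R)) ->
  0 < y ->
  (fun n => (p n)%:R / n%:R : R) @ \oo --> y ->
  {ae P, forall w,
     (fun n => levy
        (esd (spearman (fun i j => X n i w j)))
        (esd (Wmat (fun i j => dist_fun P (fun v => X n i v j)) (fun i j => X n i w j))))
     @ \oo --> (0 : R)}.
Proof.
move=> rX iX idX cX y0 py.
(* Taking countably many tolerances yields a single almost sure event valid for every e. *)
have ranks_close : {ae P, forall w, forall k, exists N, forall n, (N <= n)%N -> forall i j,
    `|(rank_of (fun i j => X n i w j) i j)%:R / n%:R -
      dist_fun P (fun v => X n i v j) (X n i w j)| <= k.+1%:R^-1}.
  apply: ae_foralln => k.
  apply: (ae_eventually_ranks_close rX iX idX cX y0 py).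
  by rewrite invr_gt0 ltr0n /= invf_le1 ?ltr0n // ler1n.
apply: filterS ranks_close => w hw.
apply/cvgrPdist_le => e e0.
(* With delta <= e ^ 2 / 40 and n >= 576 / e ^ 4, the two error terms are at most 36 e ^ 4 / 1600
   and e ^ 4 / 32, together below e ^ 4 / 16. *)
pose k := Num.truncn (40 / e ^+ 2).
have e2 : 0 < e ^+ 2 by rewrite exprn_gt0.
have hk : k.+1%:R^-1 <= e ^+ 2 / 40.
  rewrite -[e ^+ 2 / 40]invrK lef_pV2 ?posrE ?invr_gt0 ?divr_gt0 // invf_div.
  exact/ltW/truncnS_gt.
have [N hN] := hw k.
(* Positivity of the limit y forces p n > 0 eventually. *)
have [N1 _ hN1] := cvgr_gt _ py _ y0.
pose N2 := (Num.truncn (576 / e ^+ 4)).+1.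
exists (maxn (maxn N N1) (maxn N2 2)) => // n.
rewrite /= !geq_max => /andP[/andP[nN nN1] /andP[nN2 n2]].
have p0 : (0 < p n)%N.
  have := hN1 n nN1; rewrite /= lt0n; apply: contraTneq => ->.
  by rewrite mul0r ltxx.
rewrite sub0r normrN ger0_norm ?levy_ge0 //.
apply: (@levy_spearman_Wmat_le R n (p n) _ _ k.+1%:R^-1 e) => //; last 2 first.
- by move=> i j; apply: dist_fun_ge0_le1; exact: rX.
- by move=> i j; exact: hN.
have d2 : k.+1%:R^-1 ^+ 2 <= e ^+ 4 / 1600.
  have -> : e ^+ 4 / 1600 = (e ^+ 2 / 40) ^+ 2 by field.
  by rewrite lerXn2r ?nnegrE ?invr_ge0 ?divr_ge0 // ltW.
have n2' : 2 <= n%:R :> R by rewrite ler_nat.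
have M0 : n%:R <= n%:R ^+ 2 - 1 :> R by nra.
have e4 : 0 < e ^+ 4 by rewrite exprn_gt0.
have hn : 576 / e ^+ 4 <= n%:R.
  by apply: (@le_trans _ _ N2%:R); [exact/ltW/truncnS_gt | rewrite ler_nat].
have : 18 / (n%:R ^+ 2 - 1) <= e ^+ 4 / 32.
  rewrite ler_pdivrMr; last by lra.
  move: hn; rewrite ler_pdivrMr // => hn; nra.
have : 36 * k.+1%:R^-1 ^+ 2 <= 36 * (e ^+ 4 / 1600) by rewrite ler_pM2l.
move=> h1 h2; apply: (le_trans (lerD h2 h1)); lra.
Qed.
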